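(* Let $\Bbbk$ be a field, let $n\ge 3$, let $C_n$ be the cycle on vertices $x_1,\dots,x_n$, and let $\mathcal C$ be a maximal (with respect to inclusion) independent set of $C_n$. Let $R=\Bbbk[x_1,\dots,x_n]$, $S=R[z]$, and let $G=C_n(\mathcal C)$ be the $\mathcal C$-suspension of $C_n$ with new vertex $z$. Then $\mathfrak a(S/I(G))=\mathfrak a(R/I(C_n))=0$.
   Context: For a finite simple graph $H$ whose vertices are identified with the variables of a polynomial ring over $\Bbbk$, the edge ideal $I(H)$ is the ideal generated by the products $uv$ over all edges $\{u,v\}$ of $H$. An independent set is a set of pairwise non-adjacent vertices. For a graph $H$ and $\mathcal C\subseteq V(H)$, the $\mathcal C$-suspension $H(\mathcal C)$ is obtained from $H$ by adjoining a new vertex $z$ joined to every vertex of $\mathcal C$ and to no other vertices; thus $I(G)=I(C_n)+(zx_i:x_i\in\mathcal C)\subseteq S$. For a standard graded $\Bbbk$-algebra $A$ of Krull dimension $d$ with Hilbert series $h_A(t)/(1-t)^d$, $h_A$ a polynomial, the $\mathfrak a$-invariant is $\mathfrak a(A)=\deg h_A(t)-d$. *)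

(* Defs.v *)
From HB Require Import structures.
From mathcomp Require Import all_boot all_order all_algebra ring_quotient.
From mathcomp Require Import mpoly boolp.

Set Implicit Arguments.
Unset Strict Implicit.
Unset Printing Implicit Defensive.

Import GRing.Theory.
Local Open Scope ring_scope.
Local Open Scope quotient_scope.

Section Graphs.

(* Graphs on the vertex set {0, ..., n-1} are given by their adjacency
   relation. *)
Variables (n : nat) (e : rel 'I_n).

Definition independent (A : {set 'I_n}) : bool :=
  [forall i in A, forall j in A, ~~ e i j].

Definition maximal_independent (A : {set 'I_n}) : bool := maxset independent A.

(* The vertices of the C-suspension are those of the graph, embedded by
   [lift ord_max] (which preserves the value of the index), and the new vertex
   z = [ord_max]. *)
Definition suspension (C : {set 'I_n}) : rel 'I_n.+1 := fun u v =>
  match unlift ord_max u, unlift ord_max v with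
  | Some i, Some j => e i j
  | Some i, None => i \in C
  | None, Some j => j \in C
  | None, None => false
  end.

Lemma suspension_sym C : ssrbool.symmetric e -> ssrbool.symmetric (suspension C).
Proof.
move=> se u v; rewrite /suspension.
by case: (unlift _ u) => [i|]; case: (unlift _ v) => [j|].
Qed.

Lemma suspension_irr C : irreflexive e -> irreflexive (suspension C).
Proof. by move=> ie u; rewrite /suspension; case: unlift. Qed.

End Graphs.

(* [ordS] is the successor modulo n, so this is a simple graph, and is the
   cycle C_n, only for n >= 3. *)
Definition cycle_graph (n : nat) : rel 'I_n :=
  fun i j => (j == ordS i) || (i == ordS j).

Lemma cycle_graph_sym n : ssrbool.symmetric (@cycle_graph n).
Proof. by move=> i j; rewrite /cycle_graph orbC. Qed.

Lemma cycle_graph_irr n : (3 <= n)%N -> irreflexive (@cycle_graph n).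
Proof.
move=> n3 i; rewrite /cycle_graph orbb; apply/negbTE/eqP => /(congr1 val) /=.
have := ltn_ord i; rewrite leq_eqVlt => /orP[/eqP iE|lt_i].
  by rewrite iE modnn => i0; rewrite -iE i0 in n3.
by rewrite modn_small // => /eqP; rewrite eqn_leq ltnn andbF.
Qed.

Section EdgeIdeal.

Variables (k : fieldType) (n : nat) (e : rel 'I_n).

Definition edge_ideal : {pred {mpoly k[n]}} := fun f =>
  `[< exists g : 'I_n -> 'I_n -> {mpoly k[n]},
        f = \sum_(i < n) \sum_(j < n | e i j) g i j * ('X_i * 'X_j) >].

Lemma edge_idealP f :
  reflect (exists g : 'I_n -> 'I_n -> {mpoly k[n]},
             f = \sum_(i < n) \sum_(j < n | e i j) g i j * ('X_i * 'X_j))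
          (f \in edge_ideal).
Proof. exact: asboolP. Qed.

Lemma edge_ideal_idealr_closed : idealr_closed edge_ideal.
Proof.
split=> [||a f1 f2 /edge_idealP[g1 ->] /edge_idealP[g2 ->]].
- apply/edge_idealP; exists (fun _ _ => 0).
  by rewrite big1 // => i _; rewrite big1 // => j _; rewrite mul0r.
- apply/negP => /edge_idealP[g] /(congr1 (mpoly.meval (fun _ => 0))).
  rewrite rmorph1 raddf_sum big1 => [/eqP|i _]; first by rewrite oner_eq0.
  by rewrite raddf_sum big1 // => j _ /=; rewrite !mevalM mevalXU mul0r mulr0.
apply/edge_idealP; exists (fun i j => a * g1 i j + g2 i j).
rewrite mulr_sumr -big_split; apply: eq_bigr => i _.
rewrite mulr_sumr -big_split; apply: eq_bigr => j _ /=.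
by rewrite mulrDl -(mulrA a).
Qed.

HB.instance Definition _ :=
  isIdealr.Build {mpoly k[n]} edge_ideal edge_ideal_idealr_closed.

End EdgeIdeal.

Arguments edge_ideal k {n} e _.

(* The quotient of a commutative k-algebra by an ideal is a k-algebra. *)
Section QuotientAlgebra.

Variables (k : fieldType) (R : comAlgType k) (I : idealr R).
Local Notation Q := {ideal_quot I}.

Definition quot_scale (c : k) (x : Q) : Q := \pi_Q (c *: 1 : R) * x.

Fact quot_scaleA a b x : quot_scale a (quot_scale b x) = quot_scale (a * b) x.
Proof.
by rewrite /quot_scale mulrA -rmorphM -scalerAl mul1r scalerA.
Qed.

Fact quot_scale1 : left_id 1 quot_scale.
Proof. by move=> x; rewrite /quot_scale scale1r rmorph1 mul1r. Qed.

Fact quot_scaleDr : right_distributive quot_scale +%R.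
Proof. by move=> c x y; rewrite /quot_scale mulrDr. Qed.

Fact quot_scaleDl x : {morph quot_scale^~ x : a b / a + b}.
Proof. by move=> a b; rewrite /quot_scale scalerDl rmorphD mulrDl. Qed.

HB.instance Definition _ := GRing.Zmodule_isLmodule.Build k Q
  quot_scaleA quot_scale1 quot_scaleDr quot_scaleDl.

Fact quot_scaleAl (c : k) (x y : Q) : c *: (x * y) = c *: x * y.
Proof. exact: mulrA. Qed.

HB.instance Definition _ := GRing.Lmodule_isLalgebra.Build k Q quot_scaleAl.

Fact quot_scaleAr (c : k) (x y : Q) : c *: (x * y) = x * (c *: y).
Proof. exact: mulrCA. Qed.

HB.instance Definition _ := GRing.Lalgebra_isAlgebra.Build k Q quot_scaleAr.

End QuotientAlgebra.

Definition quot_alg (k : fieldType) (R : comAlgType k) (I : idealr R) :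
  comAlgType k := {ideal_quot I}.

Definition edge_ring (k : fieldType) (n : nat) (e : rel 'I_n) : comAlgType k :=
  quot_alg (edge_ideal k e : idealr {mpoly k[n]}).

Definition edge_ring_comp (k : fieldType) (n : nat) (e : rel 'I_n)
    (i : nat) (a : edge_ring k e) : Prop :=
  exists2 f : {mpoly k[n]}, f \is i.-homog &
    a = \pi_{ideal_quot (edge_ideal k e)} f.

Arguments edge_ring_comp k {n} e i a.

Section KrullDimension.

Variable A : comNzRingType.

Definition prime_ideal (P : {pred A}) : Prop :=
  idealr_closed P /\ prime_idealr_closed P.

Definition prime_chain (d : nat) (P : nat -> {pred A}) : Prop :=
  (forall i, (i <= d)%N -> prime_ideal (P i)) /\
  (forall i, (i < d)%N ->
     {subset P i <= P i.+1} /\ exists2 x, x \in P i.+1 & x \notin P i).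

Definition krull_dim (d : nat) : Prop :=
  (exists P, prime_chain d P) /\
  (forall d' P, prime_chain d' P -> (d' <= d)%N).

Lemma krull_dim_unique d1 d2 : krull_dim d1 -> krull_dim d2 -> d1 = d2.
Proof.
move=> [[P1 c1] m1] [[P2 c2] m2].
by apply/eqP; rewrite eqn_leq (m2 _ _ c1) (m1 _ _ c2).
Qed.

End KrullDimension.

Section AInvariant.

Variable k : fieldType.

(* The subspace V of A has a basis with r elements. *)
Definition has_dim (A : lmodType k) (V : A -> Prop) (r : nat) : Prop :=
  exists b : 'I_r -> A,
    [/\ forall i, V (b i),
        forall c : 'I_r -> k, \sum_i c i *: b i = 0 -> forall i, c i = 0
      & forall x, V x -> exists c : 'I_r -> k, x = \sum_i c i *: b i].

(* h(t) = (1 - t)^d * \sum_i H(i) t^i as formal power series, compared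
   coefficient by coefficient *)
Definition hilbert_numerator (H : nat -> nat) (d : nat) (h : {poly int}) :=
  forall i, h`_i =
    \sum_(j < i.+1) ((1 - 'X : {poly int}) ^+ d)`_j * (H (i - j)%N)%:Z.

(* A is graded by the subspaces comp i; a = deg h_A - dim A. *)
Definition a_invariant (A : comAlgType k) (comp : nat -> A -> Prop) (a : int) :
    Prop :=
  exists (d : nat) (H : nat -> nat) (h : {poly int}),
    [/\ krull_dim A d,
        forall i, has_dim (comp i) (H i),
        hilbert_numerator H d h,
        h != 0
      & a = (size h).-1%:Z - d%:Z].

Lemma has_dim_leq (A : lmodType k) (V : A -> Prop) r s :
  has_dim V r -> has_dim V s -> (r <= s)%N.
Proof.
move=> [b [Vb fb _]] [c [_ _ gc]].
have /choice [M bE] : forall i, exists m : 'I_s -> k, b i = \sum_j m j *: c j.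
  by move=> i; apply: gc.
pose N := \matrix_(i < r, j < s) M i j.
suff fN : row_free N by rewrite -(eqP fN) rank_leq_col.
rewrite -kermx_eq0; apply/eqP/row_matrixP => i; rewrite row0.
have /matrixP uN : row i (kermx N) *m N = 0 by rewrite -row_mul mulmx_ker row0.
apply/rowP => j; rewrite [RHS]mxE; move: j; apply: fb.
under eq_bigr => j _ do rewrite bE scaler_sumr.
rewrite exchange_big big1 //= => l _.
under eq_bigr => j _ do rewrite scalerA.
rewrite -scaler_suml; move: (uN 0 l); rewrite mxE [in RHS]mxE.
under eq_bigr => j _ do rewrite [N _ _]mxE.
by move=> ->; rewrite scale0r.
Qed.

Lemma a_invariant_unique (A : comAlgType k) (comp : nat -> A -> Prop) a1 a2 :
  a_invariant comp a1 -> a_invariant comp a2 -> a1 = a2.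
Proof.
move=> [d1 [H1 [h1 [kd1 hd1 hn1 _ ->]]]] [d2 [H2 [h2 [kd2 hd2 hn2 _ ->]]]].
rewrite -(krull_dim_unique kd1 kd2) in hn2 *.
suff -> : h1 = h2 by [].
apply/polyP => i; rewrite hn1 hn2; apply: eq_bigr => j _.
congr (_ * _%:Z); apply/eqP.
by rewrite eqn_leq (has_dim_leq (hd1 _) (hd2 _)) (has_dim_leq (hd2 _) (hd1 _)).
Qed.

End AInvariant.

(* Main.v *)
From HB Require Import structures.
Require Import Defs.
From mathcomp Require Import all_boot all_order all_algebra ring_quotient mpoly.
From mathcomp Require Import boolp zify ring.

(** The Hilbert series of a Stanley-Reisner ring of dimension [d] has numerator
    [\sum_A t^|A| (1 - t)^(d - |A|)], summed over the faces [A] (here the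
    independent sets), so the coefficient of [t^d] is, up to sign, the
    alternating count [Z = \sum_A (-1)^|A|], and the a-invariant vanishes iff
    [Z <> 0].  For the cycle, the deletion formula
    [Z(U) = Z(U - v) - Z(U - N[v])] gives a recurrence of anti-period 3, whence
    [Z(C_n) = +-2] if [3 | n] and [+-1] otherwise.  Deleting the new vertex,
    [Z(C_n(C)) = Z(C_n) - Z(C_n - C)].  If [C_n - C] has an isolated vertex, the
    second term is 0; otherwise all gaps of the maximal independent set [C] have
    length 2, so [3 | n], [C_n - C] is a perfect matching, and the second term
    is [+-1] while the first is [+-2].

    For the Krull dimension, a strict prime chain of length [l] yields, for each
    [N], [N.+1 ^ l] linearly independent monomials of degree [O(N)] in elements
    separating consecutive primes; the Hilbert function bounds [l] by [d]. *)

Set Implicit Arguments.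
Unset Strict Implicit.
Unset Printing Implicit Defensive.

Import GRing.Theory.
Local Open Scope ring_scope.

(** * Alternating counts of independent sets and vertex deletion *)

Section IndependencePolynomial.

Variables (n : nat) (e : rel 'I_n).

(** The independence polynomial of the subgraph induced on [U], evaluated at -1. *)
Definition indep_alt (U : {set 'I_n}) : int :=
  \sum_(A : {set 'I_n} | independent e A && (A \subset U)) (-1) ^+ #|A|.

Lemma independentP (A : {set 'I_n}) :
  reflect {in A &, forall i j, ~~ e i j} (independent e A).
Proof.
apply: (iffP forall_inP) => [h i j iA jA|h i iA].
  exact: (forall_inP (h i iA)).
by apply/forall_inP => j jA; apply: h.
Qed.

Lemma independentS (A B : {set 'I_n}) :
  A \subset B -> independent e B -> independent e A.
Proof.
move=> /subsetP sAB /independentP iB; apply/independentP => i j iA jA.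
by apply: iB; apply: sAB.
Qed.

Lemma independent0 : independent e set0.
Proof. by apply/independentP => i j; rewrite inE. Qed.

Hypotheses (e_sym : ssrbool.symmetric e) (e_irr : irreflexive e).

Lemma independentU1 v (A : {set 'I_n}) :
  independent e (v |: A) = independent e A && [disjoint A & e v].
Proof.
apply/independentP/andP => [h|[/independentP indA dA] i j].
  split; first by apply/independentP => i j iA jA; apply: h; rewrite !inE ?iA ?jA orbT.
  rewrite disjoint_subset; apply/subsetP => i iA; rewrite !inE.
  by apply: h; rewrite !inE ?eqxx ?iA ?orbT.
move: dA; rewrite disjoint_subset => /subsetP dA.
rewrite !inE => /orP[/eqP->|iA] /orP[/eqP->|jA]; rewrite ?e_irr //.
- exact: dA.
- rewrite e_sym; exact: dA.
- exact: indA.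
Qed.

(** Removing [v] matches the independent sets through [v] with those avoiding its closed
    neighbourhood; the lost vertex flips the sign. *)
Lemma indep_alt_del (U : {set 'I_n}) v : v \in U ->
  indep_alt U = indep_alt (U :\ v) - indep_alt [set u in U :\ v | ~~ e v u].
Proof.
move=> vU; rewrite /indep_alt (bigID (fun A : {set 'I_n} => v \notin A)) /=.
congr (_ + _).
  by apply: eq_bigl => A; rewrite subsetD1 andbA.
rewrite -sumrN.
rewrite (reindex_onto (fun A => v |: A) (fun A => A :\ v)) /=; last first.
  by move=> A /andP[_ vA]; rewrite setD1K // -(negbK (v \in A)).
rewrite [in RHS]big_mkcond [LHS]big_mkcond; apply: eq_bigr => A _ /=.
rewrite setU11 /= andbT subUset sub1set vU /=.
have -> : ((v |: A) :\ v == A) = (v \notin A).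
  apply/eqP/idP => [<-|vA]; first by rewrite !inE eqxx.
  by rewrite setU1K.
rewrite independentU1.
have -> : (A \subset [set u in U :\ v | ~~ e v u]) =
    [&& [disjoint A & e v], A \subset U & v \notin A].
  rewrite -subsetD1 disjoint_subset [RHS]andbC.
  apply/subsetP/andP => [h|[/subsetP h2 /subsetP h1] i iA].
    by split; apply/subsetP => i /h; rewrite !inE => /andP[].
  by have := h1 i iA; have := h2 i iA; rewrite !inE => -> ->.
rewrite !andbA; case: ifP => //= /andP[_ vA].
by rewrite cardsU1 vA exprS mulN1r.
Qed.

Lemma indep_alt_set0 : indep_alt set0 = 1.
Proof.
rewrite /indep_alt (big_pred1 set0) ?cards0 // => A.
rewrite subset0 /=; have [->|] := eqVneq A set0; rewrite ?andbF ?andbT //.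
exact: independent0.
Qed.

(** Both terms of the deletion formula are then taken over [U :\ v] and cancel. *)
Lemma indep_alt_isolated (U : {set 'I_n}) v :
  v \in U -> {in U, forall u, ~~ e v u} -> indep_alt U = 0.
Proof.
move=> vU iv; rewrite (indep_alt_del vU).
have -> : [set u in U :\ v | ~~ e v u] = U :\ v; last by rewrite subrr.
apply/setP => u; rewrite !inE; case: (boolP (u \in U)) => [/iv ->|_];
  by rewrite ?andbT ?andbF.
Qed.

End IndependencePolynomial.

(** * Paths and cycles *)

Section Cycle.

Variable m : nat.
Local Notation n := m.+3.
Local Notation cyc := (@cycle_graph n).

(** Two consecutive values are carried along, which makes the two-step recurrence structural; the
    empty path counts 1, the single vertex 0. *)
Fixpoint path_alt_pair (l : nat) : int * int :=
  if l is l'.+1 then let: (a, b) := path_alt_pair l' in (b, b - a) else (1, 0).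

Definition path_alt l := (path_alt_pair l).1.

Lemma path_altSS l : path_alt l.+2 = path_alt l.+1 - path_alt l.
Proof. by rewrite /path_alt /=; case: (path_alt_pair l). Qed.

(** Adjacency without modular arithmetic, in a form that [lia] can decide. *)
Lemma cycle_graphE (i j : 'I_n) :
  cyc i j = [|| j == i.+1 :> nat, i == j.+1 :> nat,
              (i == 0 :> nat) && (j == m.+2 :> nat) |
              (j == 0 :> nat) && (i == m.+2 :> nat)].
Proof.
have E (a b : 'I_n) : (b == ordS a) =
    (b == a.+1 :> nat) || ((b == 0 :> nat) && (a == m.+2 :> nat)).
  rewrite -val_eqE /=.
  have [/eqP aE|aN] := eqVneq (val a) m.+2.
    by rewrite (eqP aE) modnn; case: b => b /= hb; lia.
  by rewrite modn_small; case: a b aN => a ha [b hb] /=; lia.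
rewrite /cycle_graph !E; lia.
Qed.

Definition segment (a b : nat) : {set 'I_n} := [set i : 'I_n | a <= i < b]%N.

(** As [0 < a], the wrap-around edge is absent and the segment induces a path; deleting its last
    vertex gives the recurrence. *)
Lemma indep_alt_segment a l : (0 < a)%N -> (a + l <= n)%N ->
  indep_alt cyc (segment a (a + l)) = path_alt l.
Proof.
move=> a0; elim/ltn_ind: l => -[|[|l]] IH le_n.
- have -> : segment a (a + 0) = set0 by apply/setP => i; rewrite !inE; lia.
  exact: indep_alt_set0.
- have lta : (a < n)%N by lia.
  apply: (@indep_alt_isolated _ _ (@cycle_graph_sym n) (@cycle_graph_irr n isT)
    _ (Ordinal lta)); first by rewrite !inE /=; lia.
  move=> u; rewrite !inE cycle_graphE /=; lia.
have ltv : (a + l.+1 < n)%N by lia.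
rewrite (@indep_alt_del _ _ (@cycle_graph_sym n) (@cycle_graph_irr n isT)
    _ (Ordinal ltv)); last by rewrite !inE /=; lia.
rewrite path_altSS -(IH l.+1) ?(ltnSn, leqnn) //; try lia.
rewrite -(IH l); try lia.
congr (_ - _); congr (indep_alt _ _); apply/setP => i;
  rewrite !inE ?cycle_graphE -val_eqE /=; lia.
Qed.

(** Deleting vertex 0 leaves a path on [m.+2] vertices, deleting its closed neighbourhood a path on
    [m]. *)
Lemma indep_alt_cycle : indep_alt cyc setT = path_alt m.+2 - path_alt m.
Proof.
rewrite (@indep_alt_del _ _ (@cycle_graph_sym n) (@cycle_graph_irr n isT)
    _ ord0) ?inE //.
rewrite -(@indep_alt_segment 1 m.+2) // -(@indep_alt_segment 2 m) //.
congr (_ - _); congr (indep_alt _ _); apply/setP => i;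
  rewrite !inE ?cycle_graphE -?val_eqE /=; case: i => i hi /=; lia.
Qed.

End Cycle.

Lemma path_altD3 l : path_alt l.+3 = - path_alt l.
Proof. rewrite !path_altSS; ring. Qed.

Lemma indep_alt_cycle_val m : exists s : bool,
  indep_alt (@cycle_graph m.+3) setT =
  (-1) ^+ s * (if 3 %| m then 2 else 1)%N%:Z.
Proof.
rewrite indep_alt_cycle.
have [q [r [-> lr]]] : exists q r, m = (q * 3 + r)%N /\ (r < 3)%N.
  by exists (m %/ 3)%N, (m %% 3)%N; rewrite -divn_eq ltn_mod.
have E : path_alt (q * 3 + r).+2 - path_alt (q * 3 + r) =
    (-1) ^+ q * (path_alt r.+2 - path_alt r).
  elim: q => [|q IH]; first by rewrite mul1r.
  rewrite mulSn -addnA [(3 + _)%N]addnC addn3 !path_altD3 exprS -mulrA -IH; ring.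
rewrite {}E dvdn_addr ?dvdn_mull //.
(* The differences for [r = 0, 1, 2] are -2, -1 and 1, which fixes the sign bit. *)
case: r lr => [|[|[|//]]] _ /=.
- exists (~~ odd q); rewrite -signr_odd; by case: (odd q).
- exists (~~ odd q); rewrite -signr_odd; by case: (odd q).
- exists (odd q); rewrite -signr_odd; by case: (odd q).
Qed.

(** The hypothesis says that [U] induces a perfect matching. Deleting [v] isolates its partner [u],
    so only the other term survives, and it removes the pair with a sign change. *)
Lemma indep_alt_matching n (e : rel 'I_n) (U : {set 'I_n}) :
  ssrbool.symmetric e -> irreflexive e ->
  (forall v, v \in U -> exists2 u, u \in U & {in U, forall w, e v w = (w == u)}) ->
  exists s : bool, indep_alt e U = (-1) ^+ s.
Proof.
move=> e_sym e_irr; have [N] := ubnP #|U|; elim: N U => // N IH U ltU hU.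
have [->|[v vU]] := set_0Vmem U; first by exists false; rewrite indep_alt_set0.
have [u uU uE] := hU v vU.
have euv : e v u by rewrite uE ?eqxx.
have neq_uv : u != v by apply: contraTneq euv => ->; rewrite e_irr.
have [w wU wE] := hU u uU.
have wv : w = v by apply/esym/eqP; rewrite -wE // e_sym.
have U1 : indep_alt e (U :\ v) = 0.
  apply: (@indep_alt_isolated _ _ e_sym e_irr _ u); rewrite ?inE ?neq_uv //.
  by move=> x; rewrite !inE => /andP[xv xU]; rewrite wE // wv.
have -> : indep_alt e U = - indep_alt e (U :\ v :\ u).
  rewrite (@indep_alt_del _ _ e_sym e_irr _ v) // U1 sub0r; congr (- indep_alt _ _).
  apply/setP => x; rewrite !inE andbC.
  by case: (boolP (x \in U)) => xU; rewrite ?andbF // uE.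
case: (IH (U :\ v :\ u)) => [|x|s ->]; last 1 first.
- by exists (~~ s); case: s; rewrite ?opprK.
- by move: ltU; rewrite (cardsD1 v) vU (cardsD1 u) !inE neq_uv uU; lia.
rewrite !inE => /and3P[xu xv xU]; have [y yU yE] := hU x xU.
exists y; last first.
  by move=> z; rewrite !inE => /and3P[_ _ zU]; rewrite yE.
rewrite !inE yU andbT; apply/andP; split; apply/eqP => yx; subst y.
  by move: xv; rewrite -wv -wE // e_sym yE ?eqxx.
by move: xu; rewrite -uE // e_sym yE ?eqxx.
Qed.

(** * Alternating counts of suspensions *)

Section Suspension.

Variables (n : nat) (e : rel 'I_n) (C : {set 'I_n}).
Local Notation susp := (suspension e C).

Lemma suspension_lift i j : susp (lift ord_max i) (lift ord_max j) = e i j.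
Proof. by rewrite /suspension !liftK. Qed.

Lemma suspension_max_lift i : susp ord_max (lift ord_max i) = (i \in C).
Proof. by rewrite /suspension liftK unlift_none. Qed.

Lemma independent_lift (A : {set 'I_n}) :
  independent susp (lift ord_max @: A) = independent e A.
Proof.
apply/independentP/independentP => h i j.
  by move=> iA jA; rewrite -suspension_lift; apply: h; apply: imset_f.
by move=> /imsetP[i' iA ->] /imsetP[j' jA ->]; rewrite suspension_lift h.
Qed.

Lemma indep_alt_lift (U : {set 'I_n}) :
  indep_alt susp (lift ord_max @: U) = indep_alt e U.
Proof.
have linj := @lift_inj n.+1 ord_max.
rewrite /indep_alt (reindex_onto (fun A : {set 'I_n} => lift ord_max @: A)
  (fun A => lift ord_max @^-1: A)) /=; last first.
  move=> A /andP[_ /subsetP sA]; apply/setP => x.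
  apply/imsetP/idP => [[y yA ->]|xA]; first by rewrite inE in yA.
  by have /imsetP[y yU xE] := sA x xA; exists y; rewrite // inE -xE.
apply: eq_big => [A|A _]; last by rewrite card_imset.
rewrite independent_lift.
have -> : lift ord_max @^-1: (lift ord_max @: A) == A.
  by apply/eqP/setP => x; rewrite inE mem_imset.
rewrite andbT; congr (_ && _); apply/subsetP/subsetP => h x.
  by move=> xA; have := h _ (imset_f (lift ord_max) xA); rewrite mem_imset.
by move=> /imsetP[y yA ->]; apply/imset_f/h.
Qed.

(** Deletion at the new vertex, whose non-neighbours among the old vertices are those outside
    [C]. *)
Lemma indep_alt_suspension : ssrbool.symmetric e -> irreflexive e ->
  indep_alt susp setT = indep_alt e setT - indep_alt e (~: C).
Proof.
move=> e_sym e_irr.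
rewrite (@indep_alt_del _ _ (suspension_sym C e_sym) (suspension_irr C e_irr)
  _ ord_max) ?inE //.
rewrite -!indep_alt_lift; congr (_ - _); congr (indep_alt _ _);
  apply/setP => x; rewrite !inE;
  (have [y|] := unliftP ord_max x; move=> ->;
   rewrite ?eqxx ?(eq_sym _ ord_max) ?neq_lift ?mem_imset ?inE //=);
  try exact: lift_inj.
- by apply/esym/imsetP => -[y _ /eqP]; rewrite (negbTE (neq_lift _ _)).
- by rewrite suspension_max_lift.
- by apply/esym/imsetP => -[y _ /eqP]; rewrite (negbTE (neq_lift _ _)).
Qed.

End Suspension.

(** * Maximal independent sets of the cycle *)

Section MaximalIndependent.

Variable m : nat.
Local Notation n := m.+3.
Local Notation cyc := (@cycle_graph n).
Variable C : {set 'I_n}.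
Hypothesis maxC : maximal_independent cyc C.

Lemma cycle_graphS i : cyc i (ordS i).
Proof. by rewrite /cycle_graph eqxx. Qed.

Lemma cycle_graph_pred i j : cyc i j = (j == ordS i) || (j == ord_pred i).
Proof. by rewrite /cycle_graph (eq_sym i) (can2_eq (@ordSK _) (@ord_predK _)). Qed.

Lemma maximal_independentW : {in C &, forall i j, ~~ cyc i j}.
Proof. by apply/independentP; exact: maxsetp maxC. Qed.

(** Otherwise [v] could be added to [C]. *)
Lemma maximal_independent_dominates v :
  v \notin C -> (ordS v \in C) || (ord_pred v \in C).
Proof.
move=> vC; apply: contraT; rewrite negb_or => /andP[sC pC].
suff iv : independent cyc (v |: C).
  by move: vC; rewrite -(maxsetsup maxC iv (subsetUr _ _)) setU11.
rewrite independentU1 ?(maxsetp maxC) //; last first.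
- exact: cycle_graph_irr.
- exact: cycle_graph_sym.
rewrite disjoint_subset; apply/subsetP => u uC; rewrite !inE -topredE /=.
rewrite cycle_graph_pred negb_or; apply/andP.
by split; apply: contraTneq uC => ->.
Qed.

Hypothesis noiso : {in ~: C, forall v, exists2 u, u \in ~: C & cyc v u}.

(** Maximality puts one neighbour of [v] in [C] and [noiso] puts one outside, so exactly one of the
    two is in [C]. *)
Lemma no_isolated_pred v : v \notin C -> (ord_pred v \in C) = (ordS v \notin C).
Proof.
move=> vC; have := maximal_independent_dominates vC.
have [|u] := noiso (x := v); first by rewrite inE.
rewrite inE cycle_graph_pred => uC /orP[/eqP uE|/eqP uE]; rewrite uE in uC.
  by rewrite (negbTE uC) /=.
by rewrite (negbTE uC) orbF => ->.
Qed.

(** Independence settles the first successor; [no_isolated_pred], applied at the first and then at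
    the second, settles the other two. *)
Lemma no_isolated_step v : v \in C ->
  [/\ ordS v \notin C, ordS (ordS v) \notin C & ordS (ordS (ordS v)) \in C].
Proof.
move=> vC; have v1 : ordS v \notin C.
  by apply/negP => v1; have := maximal_independentW vC v1; rewrite cycle_graphS.
have v2 : ordS (ordS v) \notin C by rewrite -no_isolated_pred // ordSK.
split=> //; apply: contraNT v1; rewrite -(no_isolated_pred v2) ordSK.
exact: id.
Qed.

(** Since [n] is [m.+3], this amounts to 3 dividing [n]. Steps of three preserve [C], while [n]
    steps return to [v]; a remainder 1 or 2 would put [v] outside [C]. *)
Lemma no_isolated_dvd3 : (3 %| m)%N.
Proof.
have [v vC] : exists v, v \in C.
  have [|h] := boolP (ord0 \in C); first by exists ord0.
  by case/orP: (maximal_independent_dominates h) => h'; eexists; exact: h'.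
have it q : iter (3 * q) (@ordS n) v \in C.
  elim: q => // q IH; rewrite mulnS iterD /=.
  by have [] := no_isolated_step IH.
have itn : iter n (@ordS n) v = v.
  apply/val_inj; have E j : val (iter j (@ordS n) v) = ((v + j) %% n)%N.
    elim: j => [|j IH]; first by rewrite addn0 modn_small.
    by rewrite iterS [LHS]/= IH addnS -[in LHS]add1n modnDmr add1n.
  by rewrite E modnDr modn_small.
have [q [r [mE lr]]] : exists q r, n = (r + 3 * q)%N /\ (r < 3)%N.
  by exists (n %/ 3)%N, (n %% 3)%N; rewrite ltn_mod mulnC addnC -divn_eq.
have [s1 s2 _] := no_isolated_step (it q).
case: r lr mE => [|[|[|//]]] _ mE.
- by lia.
- by move: s1; rewrite -iterS (_ : (3 * q).+1 = n) ?itn ?vC // mE.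
- by move: s2; rewrite -!iterS (_ : (3 * q).+2 = n) ?itn ?vC // mE.
Qed.

End MaximalIndependent.

(** * Nonvanishing of the two counts *)

Lemma indep_alt_cycle_neq0 m : indep_alt (@cycle_graph m.+3) setT != 0.
Proof.
have [s ->] := indep_alt_cycle_val m.
by rewrite mulf_neq0 ?signr_eq0 //; case: ifP.
Qed.

Lemma indep_alt_suspension_cycle_neq0 m (C : {set 'I_m.+3}) :
  maximal_independent (@cycle_graph m.+3) C ->
  indep_alt (suspension (@cycle_graph m.+3) C) setT != 0.
Proof.
move=> maxC; have csym := @cycle_graph_sym m.+3.
have cirr := @cycle_graph_irr m.+3 isT.
rewrite indep_alt_suspension //.
have [/existsP[v /andP[vC /forall_inP iv]]|/existsPn noiso] :=
  boolP [exists v, (v \in ~: C) && [forall u in ~: C, ~~ cycle_graph v u]].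
  rewrite (indep_alt_isolated csym cirr vC); last by move=> u /iv.
  by rewrite subr0 indep_alt_cycle_neq0.
have {}noiso : {in ~: C, forall v, exists2 u, u \in ~: C & cycle_graph v u}.
  move=> v vC; have := noiso v; rewrite vC /= negb_forall => /existsP[u].
  by rewrite negb_imply negbK => /andP[uC vu]; exists u.
have [s ->] := indep_alt_cycle_val m.
rewrite (no_isolated_dvd3 maxC noiso).
(* The partner of a vertex outside [C] is its unique neighbour outside [C]. *)
have [|s' ->] := @indep_alt_matching _ _ (~: C) csym cirr.
  move=> v vC; have := vC; rewrite inE => nvC.
  have pE := no_isolated_pred maxC noiso nvC.
  have [sC|sC] := boolP (ordS v \in C).
    exists (ord_pred v); first by rewrite inE pE sC.
    move=> w; rewrite inE cycle_graph_pred => wC.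
    by case: eqP => // wE; rewrite wE sC in wC.
  exists (ordS v); first by rewrite inE.
  move=> w; rewrite inE cycle_graph_pred => wC.
  by case: eqP => //= _; apply/eqP => wE; rewrite wE pE sC in wC.
(* What remains is a difference of 2 and 1, each up to sign. *)
by case: s; case: s'.
Qed.

(** * Membership in the edge ideal through monomial supports *)

Section MonomialBasis.

Variables (k : fieldType) (n : nat) (e : rel 'I_n).
Hypothesis e_irr : irreflexive e.

Definition mnm_supp (m : 'X_{1..n}) : {set 'I_n} := [set i | (0 < m i)%N].

(** The ideal is spanned by monomials, and contains a monomial exactly when the support has an
    edge. *)
Lemma edge_ideal_coef (f : {mpoly k[n]}) :
  reflect (forall m, independent e (mnm_supp m) -> f@_m = 0)
          (f \in edge_ideal k e).
Proof.
apply: (iffP idP) => [/edge_idealP[g ->] m indm|h].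
  rewrite raddf_sum big1 // => i _; rewrite raddf_sum big1 // => j eij /=.
  rewrite -mpolyXD; apply: memN_msupp_eq0; rewrite (perm_mem (msuppMX _ _)).
  apply/mapP => -[m' _ mE]; have := independentP _ _ indm i j.
  by rewrite !inE eij mE !mnmDE !mnm1E !eqxx add1n addnS => /(_ isT isT).
rewrite [f]mpolyE big_seq; apply: rpred_sum => m; rewrite mcoeff_msupp => fm.
have /existsP[i /andP[mi /existsP[j /andP[mj eij]]]] :
    [exists i, (0 < m i)%N && [exists j, (0 < m j)%N && e i j]].
  apply: contraNT fm => /existsPn h'; apply/eqP/h/independentP => i j.
  rewrite !inE => mi mj; have := h' i; rewrite mi /= => /existsPn/(_ j).
  by rewrite mj.
(* For a loop, a positive exponent at [i] would not make the square of ['X_i] divide the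
   monomial. *)
have nij : i != j by apply: contraTneq eij => ->; rewrite e_irr.
have mE : m = (U_(i) + U_(j) + (m - (U_(i) + U_(j))))%MM.
  apply/mnmP => x; rewrite !(mnmDE, mnmBE) !mnm1E.
  have [ix|_] := eqVneq i x; have [jx|_] := eqVneq j x; subst=> /=; try lia.
  by rewrite eqxx in nij.
rewrite mE [X in _ *: X]mpolyXD mpolyXD [X in _ *: X]mulrC -mul_mpolyC mulrA.
have -> : forall g : {mpoly k[n]}, g * ('X_i * 'X_j) =
  \sum_(i' < n) \sum_(j' < n | e i' j')
    (if (i' == i) && (j' == j) then g else 0) * ('X_i' * 'X_j').
  move=> g; rewrite (bigD1 i) //= (bigD1 j) //= !eqxx /= !big1 ?addr0 //.
    by move=> i' ni; apply: big1 => j' _; rewrite (negbTE ni) mul0r.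
  by move=> j' /andP[_ nj]; rewrite (negbTE nj) mul0r.
apply/edge_idealP; eexists; reflexivity.
Qed.

End MonomialBasis.

(** * The projection onto the edge ring *)

Section EdgeRing.

Variables (k : fieldType) (n : nat) (e : rel 'I_n).

Definition edge_proj (f : {mpoly k[n]}) : edge_ring k e :=
  (\pi_{ideal_quot (edge_ideal k e)} f)%qT.

Lemma edge_projD : {morph edge_proj : f g / f + g}.
Proof. exact: rmorphD. Qed.

Lemma edge_projM : {morph edge_proj : f g / f * g}.
Proof. exact: rmorphM. Qed.

Lemma edge_proj0 : edge_proj 0 = 0. Proof. exact: rmorph0. Qed.

Lemma edge_proj1 : edge_proj 1 = 1. Proof. exact: rmorph1. Qed.

(** Scaling in the quotient is by definition multiplication by the class of [c *: 1]. *)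
Lemma edge_projZ c f : edge_proj (c *: f) = c *: edge_proj f.
Proof.
have -> : c *: f = (c *: 1) * f by rewrite -scalerAl mul1r.
exact: edge_projM.
Qed.

Lemma edge_proj_sum (I : finType) (F : I -> {mpoly k[n]}) :
  edge_proj (\sum_i F i) = \sum_i edge_proj (F i).
Proof. exact: (big_morph _ edge_projD edge_proj0). Qed.

Lemma edge_proj_eq f g : edge_proj f = edge_proj g <-> f - g \in edge_ideal k e.
Proof.
rewrite Quotient.idealrBE; split=> [/eqP|/eqP]; exact.
Qed.

Lemma edge_proj_eq0 f : edge_proj f = 0 <-> f \in edge_ideal k e.
Proof. by rewrite -edge_proj0 edge_proj_eq subr0. Qed.

Lemma edge_proj_surj (a : edge_ring k e) : exists f, a = edge_proj f.
Proof. by exists (generic_quotient.repr a); rewrite /edge_proj generic_quotient.reprK. Qed.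

End EdgeRing.

(** * Bounded exponent vectors *)

Section Box.

Variables (n E : nat).
Implicit Types b : {ffun 'I_n -> 'I_E.+1}.

(** Bounding the exponents by [E] gives a finite type, which can be counted and summed over. *)
Definition box_mnm b : 'X_{1..n} := [multinom (b i : nat) | i < n].

Definition box_supp b : {set 'I_n} := [set i | (0 < b i)%N].

Lemma mnm_supp_box b : mnm_supp (box_mnm b) = box_supp b.
Proof. by apply/setP => i; rewrite !inE mnmE. Qed.

Lemma mdeg_box b : mdeg (box_mnm b) = (\sum_i b i)%N.
Proof. by rewrite mdegE; apply: eq_bigr => i _; rewrite mnmE. Qed.

Lemma box_mnm_inj : injective box_mnm.
Proof.
move=> b1 b2 /mnmP h; apply/ffunP => i; apply/val_inj.
by have := h i; rewrite !mnmE.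
Qed.

Lemma box_mnm_surj m : (mdeg m <= E)%N -> exists b, m = box_mnm b.
Proof.
move=> le_m; exists [ffun i => inord (m i)]; apply/mnmP => i.
rewrite mnmE ffunE inordK // ltnS (leq_trans _ le_m) // mdegE (bigD1 i) //=.
exact: leq_addr.
Qed.

Definition indep_box (e : rel 'I_n) (j : nat) : {set {ffun 'I_n -> 'I_E.+1}} :=
  [set b | independent e (box_supp b) && (\sum_i b i == j)%N].

End Box.

(** * Hilbert function of the edge ring *)

Section HilbertFunction.

Variables (k : fieldType) (n : nat) (e : rel 'I_n).
Hypothesis e_irr : irreflexive e.

(** The basis consists of the monomials of degree [j] with independent support; [j <= E] ensures
    that the box contains them all. *)
Lemma has_dim_edge_ring_comp j E : (j <= E)%N ->
  has_dim (edge_ring_comp k e j) #|indep_box E e j|.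
Proof.
move=> le_jE; pose M (i : 'I_#|indep_box E e j|) := box_mnm (enum_val i).
have Minj : injective M by move=> x y /box_mnm_inj /enum_val_inj.
have indM i : independent e (mnm_supp (M i)) && (mdeg (M i) == j).
  by rewrite mnm_supp_box mdeg_box; have := enum_valP i; rewrite inE.
have coefM (c : 'I_#|indep_box E e j| -> k) i :
    (\sum_i' c i' *: 'X_[M i'] : {mpoly k[n]})@_(M i) = c i.
  rewrite raddf_sum (bigD1 i) //= mcoeffZ mcoeffX eqxx mulr1 big1 ?addr0 //.
  by move=> i' ni; rewrite mcoeffZ mcoeffX (inj_eq Minj) (negbTE ni) mulr0.
exists (fun i => edge_proj e 'X_[M i]); split.
- move=> i; exists 'X_[M i] => //; rewrite dhomogX.
  by case/andP: (indM i).
- move=> c sum0 i; rewrite -(coefM c i).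
  move: sum0; under eq_bigr do rewrite -edge_projZ.
  rewrite -edge_proj_sum edge_proj_eq0 => /(edge_ideal_coef e_irr _); apply.
  by case/andP: (indM i).
- move=> x [f homf ->]; exists (fun i => f@_(M i)).
  under eq_bigr do rewrite -edge_projZ.
  rewrite -edge_proj_sum; apply/edge_proj_eq/(edge_ideal_coef e_irr _) => m indm.
  (* Outside degree [j] both coefficients vanish. *)
  rewrite mcoeffB; have [mj|nj] := eqVneq (mdeg m) j; last first.
    rewrite (dhomog_nemf_coeff homf nj) raddf_sum big1 ?subr0 // => i _ /=.
    rewrite mcoeffZ mcoeffX; case: eqP => [Mi|]; last by rewrite mulr0.
    by move: nj; rewrite -Mi; case/andP: (indM i) => _ ->.
  have [|b bE] := @box_mnm_surj _ E m; first by rewrite mj.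
  have bI : b \in indep_box E e j.
    by rewrite inE -mnm_supp_box -mdeg_box -bE indm mj eqxx.
  have -> : m = M (enum_rank_in bI b) by rewrite /M enum_rankK_in.
  by rewrite coefM subrr.
Qed.

Definition edge_hilbert j := #|indep_box j e j|.

(** Both sides are the dimension of the same component; hence one bound [E] serves all degrees up to
    [E]. *)
Lemma edge_hilbertE E j : (j <= E)%N -> #|indep_box E e j| = edge_hilbert j.
Proof.
move=> le_jE; have h1 := has_dim_edge_ring_comp le_jE.
have h2 := has_dim_edge_ring_comp (leqnn j).
by apply/eqP; rewrite eqn_leq (has_dim_leq h1 h2) (has_dim_leq h2 h1).
Qed.

End HilbertFunction.

(** * Numerator of the Hilbert series *)

Section HilbertSeries.

Variables (n : nat) (e : rel 'I_n).

Definition indep_number : nat :=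
  (\max_(A : {set 'I_n} | independent e A) #|A|)%N.

Definition stanley_numerator : {poly int} :=
  \sum_(A : {set 'I_n} | independent e A)
    'X^#|A| * (1 - 'X) ^+ (indep_number - #|A|).

Lemma leq_indep_number (A : {set 'I_n}) :
  independent e A -> (#|A| <= indep_number)%N.
Proof. move=> indA; exact: (leq_bigmax_cond (F := fun A : {set 'I_n} => #|A|)). Qed.

Lemma indep_number_witness : exists2 A, independent e A & #|A| = indep_number.
Proof.
have [|A indA AE] := @eq_bigmax_cond _ (independent e) (fun A : {set 'I_n} => #|A|).
  by apply/card_gt0P; exists set0; exact: independent0.
by exists A.
Qed.

(** Exponents are chosen independently at each vertex: positive on [A], and zero elsewhere, where
    the factor is 1. *)
Lemma box_supp_gf E (A : {set 'I_n}) :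
  \sum_(b : {ffun 'I_n -> 'I_E.+1} | box_supp b == A) 'X^(\sum_i b i) =
  (\sum_(j < E.+1 | (0 < j)%N) 'X^j) ^+ #|A| :> {poly int}.
Proof.
transitivity (\prod_(v : 'I_n)
    \sum_(j < E.+1 | (v \in A) == (0 < j)%N) 'X^j : {poly int}).
  rewrite bigA_distr_big_dep; apply: eq_big => [b|b _].
    apply/eqP/familyP => [<- v|h]; first by rewrite unfold_in /= inE.
    by apply/setP => v; have := h v; rewrite unfold_in /= inE => /eqP ->.
  by rewrite -expr_sum.
rewrite (bigID (mem A)) /= [X in _ * X]big1 ?mulr1 => [|v /negbTE vA].
  by rewrite -prodr_const; apply: eq_bigr => v vA; rewrite vA;
     apply: eq_bigl => j; case: (0 < j)%N.
rewrite vA (big_pred1 ord0) ?expr0 // => j.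
by rewrite /= -val_eqE /= lt0n; case: (val j == 0%N) => //; case: (0 < j)%N.
Qed.

Lemma mul_1subX_geometric E :
  (1 - 'X) * (\sum_(j < E.+1 | (0 < j)%N) 'X^j) = 'X - 'X^(E.+1) :> {poly int}.
Proof.
have h := subrX1 ('X : {poly int}) E.+1.
rewrite (bigID (fun j : 'I_E.+1 => (0 < j)%N)) /= in h.
rewrite [X in _ * (_ + X)](big_pred1 ord0) in h; last first.
  by move=> j; rewrite /= -val_eqE /= lt0n negbK.
rewrite expr0 in h; move: h; set S := \sum_(j < _ | _) _ => h.
have -> : (1 - 'X) * S = 'X - 1 - ('X - 1) * (S + 1) by ring.
by rewrite -h; ring.
Qed.

Lemma hilbert_numerator_edge (k : fieldType) : irreflexive e ->
  hilbert_numerator (edge_hilbert e) indep_number stanley_numerator.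
Proof.
move=> e_irr i.
(* Only coefficient [i] is compared, so exponents up to [i] suffice: [P] agrees with the Hilbert
   series up to degree [i]. *)
pose P : {poly int} :=
  \sum_(b : {ffun 'I_n -> 'I_i.+1} | independent e (box_supp b)) 'X^(\sum_v b v).
have coefP j : (j <= i)%N -> P`_j = (edge_hilbert e j)%:Z.
  move=> le_ji; rewrite -(edge_hilbertE k e_irr le_ji) coef_sum.
  rewrite -natz -sum1_card natr_sum /indep_box.
  rewrite [LHS](eq_bigr (fun b : {ffun 'I_n -> 'I_i.+1} => ((\sum_v b v == j)%N)%:R)); last first.
    by move=> b _; rewrite coefXn eq_sym.
  rewrite big_mkcond [RHS]big_mkcond; apply: eq_bigr => b _ /=.
  by rewrite inE; case: (independent _ _) => //=; case: eqP.
transitivity (((1 - 'X) ^+ indep_number * P)`_i); last first.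
  by rewrite coefM; apply: eq_bigr => j _; rewrite coefP ?leq_subr.
have -> : P = \sum_(A : {set 'I_n} | independent e A)
    (\sum_(j < i.+1 | (0 < j)%N) 'X^j) ^+ #|A|.
  rewrite /P (partition_big (@box_supp n i) (independent e)) //=.
  apply: eq_bigr => A indA; rewrite -box_supp_gf; apply: eq_bigl => b.
  by case: eqP => [->|]; rewrite ?indA ?andbF.
rewrite mulr_sumr !coef_sum; apply: eq_bigr => A indA.
rewrite -{2}(subnK (leq_indep_number indA)) exprD -mulrA -exprMn.
(* This factor is ['X^#|A|] up to a multiple of ['X^(i.+1)], which does not affect coefficient
   [i]. *)
have -> : ((1 - 'X) * (\sum_(j < i.+1 | (0 < j)%N) 'X^j)) ^+ #|A| =
    'X^#|A| - 'X^(i.+1) * \sum_(j < #|A|) ('X - 'X^(i.+1)) ^+ (#|A|.-1 - j) * 'X^j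
    :> {poly int}.
  have := subrXX ('X - 'X^(i.+1)) ('X : {poly int}) #|A|.
  rewrite mul_1subX_geometric => /eqP; rewrite subr_eq => /eqP ->.
  by rewrite addrC [X in X * _](_ : _ = - 'X^(i.+1)) ?mulNr //; ring.
by rewrite mulrBr coefB [_ * ('X^(i.+1) * _)]mulrCA [X in _ = _ - X]coefXnM ltnSn subr0 mulrC.
Qed.

Lemma size_1subX_exp m : (size ((1 - 'X : {poly int}) ^+ m)%R <= m.+1)%N.
Proof.
apply: leq_trans (size_poly_exp_leq _ _) _.
have : (size (1 - 'X : {poly int})%R <= 2)%N.
  by rewrite (leq_trans (size_polyD _ _)) // geq_max size_polyN size_polyX size_poly1.
by case: (size _) => [|[|[|//]]] _ /=; rewrite ?mul0n ?mul1n ?ltnS.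
Qed.

Lemma coef_1subX_exp m : ((1 - 'X : {poly int}) ^+ m)`_m = (-1) ^+ m.
Proof.
elim: m => [|m IH]; first by rewrite !expr0 coef1.
rewrite exprSr mulrBr mulr1 coefB coefMX /= IH nth_default ?size_1subX_exp //.
by rewrite sub0r exprS mulN1r.
Qed.

(** Each [A] contributes the leading coefficient of [(1 - 'X) ^+ (indep_number - #|A|)]. *)
Lemma coef_stanley_numerator :
  stanley_numerator`_indep_number = (-1) ^+ indep_number * indep_alt e setT.
Proof.
rewrite /stanley_numerator /indep_alt coef_sum mulr_sumr.
apply: eq_big => [A|A indA]; first by rewrite subsetT andbT.
rewrite coefXnM ltnNge leq_indep_number //= coef_1subX_exp.
by rewrite -signr_odd oddB ?leq_indep_number // signr_addb !signr_odd.
Qed.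

Lemma size_stanley_numerator : indep_alt e setT != 0 ->
  size stanley_numerator = indep_number.+1.
Proof.
move=> alt0; apply/eqP; rewrite eqn_leq; apply/andP; split.
  apply/leq_sizeP => j ltj; rewrite coef_sum big1 // => A indA.
  rewrite coefXnM; case: ifP => // _; rewrite nth_default //.
  apply: leq_trans (size_1subX_exp _) _.
  by have := leq_indep_number indA; lia.
rewrite ltnNge; apply/negP => /leq_sizeP/(_ _ (leqnn _)).
by rewrite coef_stanley_numerator => /eqP; rewrite mulf_eq0 signr_eq0 (negbTE alt0).
Qed.

End HilbertSeries.

(** * Independent families from prime chains *)

Section PrimeChains.

Variables (k : fieldType) (A : comAlgType k).

(** Linear independence over [k] modulo [P], stated without forming the quotient. *)
Definition free_mod (P : {pred A}) (T : finType) (b : T -> A) : Prop :=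
  forall c : T -> k, \sum_t c t *: b t \in P -> forall t, c t = 0.

Lemma prime_ideal0 (P : {pred A}) : prime_ideal P -> 0 \in P.
Proof. by case=> -[]. Qed.

Lemma prime_idealMD (P : {pred A}) a u v :
  prime_ideal P -> u \in P -> v \in P -> a * u + v \in P.
Proof. by case=> -[_ _ h] _; exact: h. Qed.

Lemma prime_ideal_scale (P : {pred A}) (c : k) u :
  prime_ideal P -> u \in P -> c *: u \in P.
Proof.
move=> pP uP; have := prime_idealMD (c *: 1) pP uP (prime_ideal0 pP).
by rewrite addr0 -scalerAl mul1r.
Qed.

(** A nonzero scalar in [P] would put 1 in [P]. *)
Lemma free_mod_one (P : {pred A}) : prime_ideal P -> free_mod P (fun _ : unit => 1).
Proof.
move=> pP c; rewrite (big_pred1 tt) => [cP []|[]//]; apply/eqP.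
apply: contraT => c0; have := prime_ideal_scale (c tt)^-1 pP cP.
by rewrite scalerA mulVf // scale1r; case: pP => -[_ /negbTE ->].
Qed.

(* Peel off the lowest power of [y]: in a relation [q 0 + y * r \in P] the
   term [q 0] lies in [P'], hence has zero coefficients, and then [y] can be
   cancelled since [P] is prime. *)
Lemma free_mod_step (P P' : {pred A}) y (T : finType) (b : T -> A) N :
  prime_ideal P -> prime_ideal P' -> {subset P <= P'} ->
  y \in P' -> y \notin P -> free_mod P' b ->
  free_mod P (fun p : 'I_N * T => y ^+ p.1 * b p.2).
Proof.
move=> pP pP' sPP' yP' yP fb c.
(* Coefficients are indexed by all of [nat] so that the induction on [M] can shift them. *)
pose g (c : nat -> T -> k) M := \sum_(j < M) y ^+ j * \sum_t c j t *: b t.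
have gP M (c' : nat -> T -> k) : g c' M \in P -> forall j, (j < M)%N -> forall t, c' j t = 0.
  elim: M c' => // M IH c'; rewrite /g big_ord_recl /= expr0 mul1r.
  have -> : \sum_(j < M) y ^+ bump 0 j * \sum_t c' (bump 0 j) t *: b t =
      y * g (fun j => c' j.+1) M.
    by rewrite mulr_sumr; apply: eq_bigr => j _; rewrite exprS mulrA.
  move=> hP; have c0 : forall t, c' 0%N t = 0.
    apply: fb.
    have := prime_idealMD (- g (fun j => c' j.+1) M) pP' yP' (sPP' _ hP).
    by rewrite mulNr mulrC addrC addrK.
  rewrite big1 ?add0r in hP => [|t _]; last by rewrite c0 scale0r.
  case: pP => _ /(_ _ _ hP); rewrite (negbTE yP) /= => /IH{}IH.
  by case=> [|j] // ltj t; apply: IH.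
move=> cP [j t]; pose c' i t := if insub i is Some i' then c (i', t) else 0.
have c'E (i : 'I_N) t' : c' i t' = c (i, t') by rewrite /c' valK.
rewrite -c'E; apply: (gP N c') => //.
suff -> : g c' N = \sum_p c p *: (y ^+ p.1 * b p.2) by [].
transitivity (\sum_(i < N) \sum_t c (i, t) *: (y ^+ i * b t)); last first.
  by rewrite pair_bigA; apply: eq_bigr => -[].
apply: eq_bigr => i _; rewrite mulr_sumr; apply: eq_bigr => t' _.
by rewrite c'E -scalerAr.
Qed.

(** [F] abstracts a filtration by degree. Each strict inclusion yields an element [y], whose powers
    up to [N] multiply the size of the family by [N.+1]; [D] adds up the degrees of these elements,
    so it does not depend on [N]. *)
Lemma prime_chain_free (F : nat -> A -> Prop) :
  (forall E E' a, (E <= E')%N -> F E a -> F E' a) -> F 0%N 1 ->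
  (forall E E' a a', F E a -> F E' a' -> F (E + E')%N (a * a')) ->
  (forall a, exists E, F E a) ->
  forall l P, prime_chain l P -> exists D, forall N,
    exists (T : finType) (b : T -> A),
      [/\ #|T| = (N.+1 ^ l)%N, free_mod (P 0%N) b & forall t, F (D * N)%N (b t)].
Proof.
move=> FW F1 FM Fex; elim=> [|l IH] P [pP cP].
  exists 0%N => N; exists unit, (fun _ => 1); split=> //; first by rewrite card_unit.
  by apply: free_mod_one; apply: pP.
have [|D hD] := IH (fun i => P i.+1).
  by split=> i ltil; [apply: pP | apply: cP].
have [sP [y yP' yP]] := cP 0%N isT; have [E FE] := Fex y.
exists (E + D)%N => N; have [T [b [cT fb Fb]]] := hD N.
exists ('I_N.+1 * T)%type, (fun p : 'I_N.+1 * T => y ^+ p.1 * b p.2); split.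
- by rewrite card_prod card_ord cT expnS.
- by apply: free_mod_step (fb) => //; apply: pP.
move=> [j t] /=; rewrite mulnDl; apply: (FM) => //.
have FX i : F (E * i)%N (y ^+ i).
  elim: i => [|i IHi]; first by rewrite muln0 expr0.
  by rewrite mulnS exprS; apply: FM.
by apply: FW (FX j); rewrite leq_mul2l -ltnS ltn_ord orbT.
Qed.

End PrimeChains.

(** * Upper bound on the Krull dimension *)

Section EdgeRingDimension.

Variables (k : fieldType) (n : nat) (e : rel 'I_n).
Hypothesis e_irr : irreflexive e.

(** There are at most [2 ^ n] supports, and a support [A] admits at most [E.+1 ^ #|A|] vectors. *)
Lemma card_indep_box E :
  (#|[set b : {ffun 'I_n -> 'I_E.+1} | independent e (box_supp b)]|
    <= 2 ^ n * E.+1 ^ indep_number e)%N.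
Proof.
pose box (A : {set 'I_n}) := [set b : {ffun 'I_n -> 'I_E.+1} | box_supp b == A].
apply: (@leq_trans (\sum_(A : {set 'I_n} | independent e A) #|box A|)%N).
  rewrite -sum1_card (partition_big (@box_supp n E) (independent e)) /=; last first.
    by move=> b; rewrite inE.
  apply: leq_sum => A indA; rewrite -sum1_card big_mkcond [leqRHS]big_mkcond /=.
  by apply: leq_sum => b _; rewrite !inE; case: eqP => [->|_]; rewrite ?indA ?andbF.
have card_box A : (#|box A| <= E.+1 ^ #|A|)%N.
  have := card_pffun_on (ord0 : 'I_E.+1) A (mem 'I_E.+1).
  rewrite card_ord => <-; apply: subset_leq_card; apply/subsetP => b.
  rewrite inE => /eqP <-; apply/pffun_onP; split=> //.
  by apply/supportP => i; rewrite inE -eqn0Ngt => /eqP bi; apply/val_inj.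
apply: (@leq_trans (\sum_(A : {set 'I_n}) E.+1 ^ indep_number e)%N).
  rewrite big_mkcond; apply: leq_sum => A _; case: ifP => // indA.
  by rewrite (leq_trans (card_box A)) // leq_pexp2l // leq_indep_number.
by rewrite sum_nat_const -cardsT -powersetT card_powerset cardsT card_ord.
Qed.

Lemma edge_ring_prime_chain_leq l (P : nat -> {pred edge_ring k e}) :
  prime_chain l P -> (l <= indep_number e)%N.
Proof.
(* [msize] is the degree plus one, so [F E] asks for a representative of degree at most [E]. *)
move=> chP; pose F E (a : edge_ring k e) :=
  exists f : {mpoly k[n]}, (msize f <= E.+1)%N /\ a = edge_proj e f.
have [|||a|D hD] := prime_chain_free (F := F) _ _ _ _ chP.
- by move=> E E' a leE [f [sf ->]]; exists f; split=> //; apply: leq_trans sf _.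
- by exists 1; rewrite msize1 edge_proj1.
- move=> E E' a a' [f [sf ->]] [f' [sf' ->]]; exists (f * f').
  split; last by rewrite edge_projM.
  have [->|f0] := eqVneq f 0; first by rewrite mul0r msize0.
  have [->|f'0] := eqVneq f' 0; first by rewrite mulr0 msize0.
  by rewrite msizeM // -subn1 leq_subLR; have := leq_add sf sf'; rewrite addSn addnS add1n.
- have [f ->] := edge_proj_surj a; exists (msize f), f.
  by split.
have bound N : (N.+1 ^ l <= 2 ^ n * (D * N).+1 ^ indep_number e)%N.
  have [T [b [cT fb /choice[f fE]]]] := hD N.
  apply: leq_trans (card_indep_box _); rewrite -cT; set B := [set b | _].
  (* A left kernel vector gives a combination of the [f t] lying in the edge ideal; its class is
     zero, hence in [P 0], and freeness forces the vector to vanish. *)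
  pose M := \matrix_(i < #|T|, j < #|B|) (f (enum_val i))@_(box_mnm (enum_val j)).
  suff fM : row_free M by rewrite -(eqP fM) rank_leq_col.
  rewrite -kermx_eq0; apply/eqP/row_matrixP => i; rewrite row0.
  have /matrixP uM : row i (kermx M) *m M = 0 by rewrite -row_mul mulmx_ker row0.
  move: (row i _) uM => u uM; apply/rowP => j; rewrite [RHS]mxE.
  rewrite -(enum_valK j); apply: (fb (fun t => u 0 (enum_rank t))).
  have -> : \sum_t u 0 (enum_rank t) *: b t =
      edge_proj e (\sum_t u 0 (enum_rank t) *: f t).
    rewrite edge_proj_sum; apply: eq_bigr => t _; rewrite edge_projZ.
    by case: (fE t) => _ ->.
  suff /edge_proj_eq0 -> : \sum_t u 0 (enum_rank t) *: f t \in edge_ideal k e.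
    by apply: prime_ideal0; case: chP => pP _; apply: pP.
  apply/(edge_ideal_coef e_irr) => m indm; rewrite raddf_sum /=.
  have [lem|gtm] := leqP (mdeg m) (D * N); last first.
    apply: big1 => t _; rewrite mcoeffZ memN_msupp_eq0 ?mulr0 //.
    apply: msize_mdeg_ge; apply: leq_trans gtm; by case: (fE t).
  have [bx bxE] := box_mnm_surj lem.
  have bxB : bx \in B by rewrite inE -mnm_supp_box -bxE.
  have := uM 0 (enum_rank_in bxB bx); rewrite !mxE => uM0.
  rewrite -[RHS]uM0 (reindex (@enum_val T predT)) /=; last first.
    by apply: onW_bij; apply: enum_val_bij.
  by apply: eq_bigr => x _; rewrite mcoeffZ !mxE enum_valK enum_rankK_in // -bxE.
rewrite leqNgt; apply/negP => ltdl; set d := indep_number e in bound ltdl.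
(* For this [N], the estimate [(D * N).+1 <= D.+1 * N.+1] bounds the right side by [N * N.+1 ^ d],
   which is below [N.+1 ^ d.+1]. *)
pose N := (2 ^ n * D.+1 ^ d)%N; have := bound N; apply/negP; rewrite -ltnNge.
apply: (@leq_trans (N.+1 ^ d.+1)); last by rewrite leq_pexp2l.
apply: (@leq_ltn_trans (N * N.+1 ^ d)); last first.
  by rewrite expnS ltn_mul2r ltnSn andbT expn_gt0.
rewrite -mulnA -expnMn leq_mul2l; apply/orP; right.
have : ((D * N).+1 <= D.+1 * N.+1)%N by lia.
by case: (d) => // d' le; rewrite leq_exp2r.
Qed.

End EdgeRingDimension.

(** * Coordinate primes *)

Section CoordinatePrimes.

Variables (k : fieldType) (n : nat) (e : rel 'I_n).

Definition coord_proj (S : {set 'I_n}) : {mpoly k[n]} -> {mpoly k[n]} :=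
  comp_mpoly [tuple if i \in S then 'X_i else 0 | i < n].

HB.instance Definition _ S := GRing.RMorphism.copy (coord_proj S)
  (comp_mpoly [tuple if i \in S then 'X_i else 0 | i < n]).

Lemma coord_projZ S c f : coord_proj S (c *: f) = c *: coord_proj S f.
Proof. exact: comp_mpolyZ. Qed.

Lemma coord_projX S i : coord_proj S 'X_i = if i \in S then 'X_i else 0.
Proof. by rewrite /coord_proj comp_mpolyXU -tnth_nth tnth_mktuple. Qed.

Lemma coord_projXm S m :
  coord_proj S 'X_[m] = \prod_i (if i \in S then 'X_i else 0) ^+ m i.
Proof.
by rewrite /coord_proj comp_mpolyX; apply: eq_bigr => i _; rewrite tnth_mktuple.
Qed.

(** It gives the inclusions of a prime chain: kernels grow as the set of surviving variables
    shrinks. *)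
Lemma coord_projS (S S' : {set 'I_n}) f : S' \subset S ->
  coord_proj S' (coord_proj S f) = coord_proj S' f.
Proof.
move=> /subsetP sS; rewrite [f]mpolyE (rmorph_sum (coord_proj S)) !(rmorph_sum (coord_proj S')).
apply: eq_bigr => m _.
rewrite /= !coord_projZ; congr (_ *: _).
rewrite !coord_projXm rmorph_prod; apply: eq_bigr => i _.
rewrite rmorphXn; congr (_ ^+ _).
have [iS|iS] := boolP (i \in S); first by rewrite /= coord_projX.
by rewrite rmorph0 (contraNF (sS i) iS).
Qed.

Variable S : {set 'I_n}.

(** Membership is tested on a chosen representative; [mem_coord_ideal] shows that the choice is
    immaterial for independent [S]. *)
Definition coord_ideal : {pred edge_ring k e} :=
  fun a => coord_proj S (generic_quotient.repr a) == 0.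

Hypothesis indS : independent e S.

(** Every edge has an endpoint outside [S], whose variable is sent to 0. *)
Lemma coord_proj_edge_ideal f : f \in edge_ideal k e -> coord_proj S f = 0.
Proof.
move=> /edge_idealP[g ->]; rewrite rmorph_sum big1 // => i _.
rewrite rmorph_sum big1 // => j eij; rewrite !rmorphM /= !coord_projX.
case: ifP => iS; last by rewrite mul0r mulr0.
case: ifP => jS; last by rewrite !mulr0.
by have := independentP _ _ indS i j iS jS; rewrite eij.
Qed.

Lemma mem_coord_ideal f : (edge_proj e f \in coord_ideal) = (coord_proj S f == 0).
Proof.
rewrite unfold_in; set a := generic_quotient.repr _; congr (_ == _).
have : edge_proj e a = edge_proj e f by rewrite /edge_proj generic_quotient.reprK.
move/edge_proj_eq/coord_proj_edge_ideal/eqP.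
by rewrite rmorphB subr_eq0 => /eqP.
Qed.

(** It is the kernel of the morphism induced by [coord_proj S] into an integral domain. *)
Lemma coord_ideal_prime : prime_ideal coord_ideal.
Proof.
split; first split.
- by rewrite -(edge_proj0 k e) mem_coord_ideal rmorph0.
- by rewrite -(edge_proj1 k e) mem_coord_ideal rmorph1 oner_eq0.
- move=> a u v; have [f ->] := edge_proj_surj a.
  have [g ->] := edge_proj_surj u; have [h ->] := edge_proj_surj v.
  rewrite -edge_projM -edge_projD !mem_coord_ideal rmorphD rmorphM.
  by move=> /eqP gE /eqP hE; rewrite /= gE hE mulr0 addr0.
- move=> u v; have [g ->] := edge_proj_surj u; have [h ->] := edge_proj_surj v.
  by rewrite -edge_projM !mem_coord_ideal rmorphM mulf_eq0.
Qed.

End CoordinatePrimes.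

(** * Krull dimension and a-invariant of the edge ring *)

Lemma edge_ring_krull_dim (k : fieldType) n (e : rel 'I_n) :
  irreflexive e -> krull_dim (edge_ring k e) (indep_number e).
Proof.
move=> e_irr; split; last first.
  by move=> l P; apply: edge_ring_prime_chain_leq.
have [A indA cA] := indep_number_witness e.
(* Dropping the vertices of a maximum independent set one at a time yields a strictly increasing
   chain of coordinate primes. *)
pose S i := [set x in drop i (enum A)].
have SA i : independent e (S i).
  apply: independentS indA; apply/subsetP => x; rewrite inE => /mem_drop.
  by rewrite mem_enum.
have sS i : S i.+1 \subset S i.
  apply/subsetP => x; rewrite !inE -add1n -drop_drop; exact: mem_drop.
exists (fun i => @coord_ideal k n e (S i)); split=> i ltid.
  exact: coord_ideal_prime.
split=> [a|].
  have [f ->] := edge_proj_surj a; rewrite !mem_coord_ideal // => /eqP f0.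
  by rewrite -(coord_projS f (sS i)) f0 rmorph0.
have lti : (i < size (enum A))%N by rewrite -cardE cA.
have [x0 _] : exists x, x \in A by apply/card_gt0P; rewrite cA; case: (_ e) ltid.
(* [x] is the vertex lost between [S i] and [S i.+1]; its variable separates the two primes. *)
have := drop_nth x0 lti; set x := nth _ _ _ => dE.
have /andP[xN _] : uniq (x :: drop i.+1 (enum A)).
  by rewrite -dE drop_uniq ?enum_uniq.
exists (edge_proj e 'X_x); rewrite mem_coord_ideal // coord_projX inE.
  by rewrite (negbTE xN).
rewrite dE mem_head; apply/eqP => /(congr1 (mcoeff U_(x))).
by rewrite mcoeffX eqxx mcoeff0 => /eqP; rewrite oner_eq0.
Qed.

(** A nonzero alternating count makes the degree of the numerator equal to the Krull dimension. *)
Lemma edge_ring_a_invariant (k : fieldType) n (e : rel 'I_n) :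
  irreflexive e -> indep_alt e setT != 0 -> a_invariant (edge_ring_comp k e) 0.
Proof.
move=> e_irr alt0.
exists (indep_number e), (edge_hilbert e), (stanley_numerator e); split.
- exact: edge_ring_krull_dim.
- by move=> i; apply: has_dim_edge_ring_comp.
- exact: hilbert_numerator_edge.
- by rewrite -size_poly_eq0 size_stanley_numerator.
- by rewrite size_stanley_numerator // subrr.
Qed.

Theorem theorem4p9 (k : fieldType) (n : nat) (n_ge3 : (3 <= n)%N)
    (C : {set 'I_n}) (maxC : maximal_independent (@cycle_graph n) C) :
  a_invariant (edge_ring_comp k (suspension (@cycle_graph n) C)) 0%R /\
  a_invariant (edge_ring_comp k (@cycle_graph n)) 0%R.
Proof.
case: n n_ge3 C maxC => [|[|[|m]]] // n_ge3 C maxC; split.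
  apply: edge_ring_a_invariant; last exact: indep_alt_suspension_cycle_neq0.
  exact/suspension_irr/cycle_graph_irr.
apply: edge_ring_a_invariant; last exact: indep_alt_cycle_neq0.
exact: cycle_graph_irr.
Qed.
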